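(* Let $f\colon\mathbb{R}\to\,]-\infty,+\infty]$ be convex, lower semicontinuous and proper, and suppose that $f$ is even, $f(0)=0$, $f(x)>0$ for all $x\neq 0$, and $f'(0)=0$. Let $A=\mathbb{R}\times\{0\}$ and $B=\operatorname{epi} f=\{(x,r)\in\mathbb{R}^2 : f(x)\leq r\}$. Let $x_0>0$ with $x_0\in\operatorname{dom} f$, let $a_0=(x_0,0)$, and for every $n\in\mathbb{N}$ let $a_{n+1}=P_AP_B(a_n)=(x_{n+1},0)$. Suppose that $f$ is differentiable on $[0,\delta]$, where $\delta>0$. For every $q\in[1,+\infty[$ set $$c_q=\lim_{x\downarrow 0}\frac{f(x)f'(x)}{x^q},$$ where $c_q$ is either undefined (if the limit does not exist) or an element of $[0,+\infty]$. Let $q\in[1,+\infty[$. Then the following hold: (i) $c_1=0$. If $c_q=0$, then $c_{q'}=0$ for all $1\leq q'<q$. If $c_q>0$, then $c_{q'}=+\infty$ for all $q'>q$. (ii) If $c_q=0$, then $$\frac{\frac{x_n}{x_{n+1}}-1}{x_{n+1}^{q-1}}\to 0,$$ and for every $\varepsilon>0$ there exists $m\in\mathbb{N}$ such that for all $n\geq m$: $$x_n\geq\begin{cases}\big(\exp(-\varepsilon)\big)^n, & \text{when } q=1;\\[2mm] \dfrac{1}{\big((q-1)n\varepsilon\big)^{1/(q-1)}}, & \text{when } q>1.\end{cases}$$ (iii) If $c_q>0$, then $q>1$ and $$\frac{x_n}{\left(\frac1n\right)^{1/(q-1)}}\to\frac{1}{\big((q-1)c_q\big)^{1/(q-1)}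}.$$
   Context: $\mathbb{N}=\{0,1,2,\dots\}$. For a nonempty closed convex set $C\subseteq\mathbb{R}^2$, $P_C$ denotes the Euclidean nearest point projection onto $C$; $\operatorname{dom} f=\{x: f(x)<+\infty\}$. A hypothesis such as ''$c_q=0$'' or ''$c_q>0$'' includes that $c_q$ is defined; $c_q>0$ allows $c_q=+\infty$, in which case the limit in (iii) is read with the convention $1/(+\infty)=0$. *)

(* Defs.v *)
From HB Require Import structures.
From mathcomp Require Import all_boot all_order all_algebra.
From mathcomp Require Import all_classical all_reals all_analysis.
Import Order.TTheory GRing.Theory Num.Theory.
Import numFieldNormedType.Exports.

Set Implicit Arguments.
Unset Strict Implicit.
Unset Printing Implicit Defensive.

Local Open Scope classical_set_scope.
Local Open Scope ring_scope.

(* The product 0 * +oo is 0 in \bar R, so the inequality is trivial at t = 0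
   and t = 1. *)
Definition econvex (R : realType) (f : R -> \bar R) : Prop :=
  forall x y t : R, 0 <= t <= 1 ->
    (f (t * x + (1 - t) * y)%R <= t%:E * f x + (1 - t)%:E * f y)%E.

Definition proper_fun (R : realType) (f : R -> \bar R) : Prop :=
  (forall x, f x != -oo%E) /\ (exists x, (f x < +oo)%E).

Definition edom (R : realType) (f : R -> \bar R) : set R :=
  [set x | (f x < +oo)%E].

Definition epi (R : realType) (f : R -> \bar R) : set (R * R) :=
  [set p | (f p.1 <= p.2%:E)%E].

(* [fine] sends infinite values to 0, so finiteness of [f] around [x] has to be
   required separately. *)
Definition ederivable (R : realType) (f : R -> \bar R) (x : R) : Prop :=
  (\forall y \near x, f y \is a fin_num) /\
  derivable (fun y => fine (f y)) x 1.

(* The derivative of [f] at [x], meaningful only when [ederivable f x]. *)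
Definition ederive (R : realType) (f : R -> \bar R) (x : R) : R :=
  derive1 (fun y => fine (f y)) x.

(* The plane is [R * R]; its library norm is the sup norm, hence this explicit
   Euclidean distance. *)
Definition eucl_dist (R : realType) (u v : R * R) : R :=
  Num.sqrt ((u.1 - v.1) ^+ 2 + (u.2 - v.2) ^+ 2).

(* The nearest point of [C] to [u]; it exists and is unique when [C] is nonempty,
   closed and convex. *)
Definition plane_proj (R : realType) (C : set (R * R)) (u : R * R) : R * R :=
  get [set p | C p /\ forall z, C z -> eucl_dist u p <= eucl_dist u z].

(* [is_c f q c] says that c_q is defined and equal to [c]. *)
Definition is_c (R : realType) (f : R -> \bar R) (q : R) (c : \bar R) : Prop :=
  (f x * (ederive f x)%:E / (x `^ q)%:E)%E @[x --> 0^'+] --> c.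

(* Main.v *)
Require Import Defs.
From HB Require Import structures.
From mathcomp Require Import all_boot all_order all_algebra.
From mathcomp Require Import all_classical all_reals all_analysis.
From mathcomp Require Import ring lra.
Import Order.TTheory GRing.Theory Num.Theory.
Import numFieldNormedType.Exports.

Set Implicit Arguments.
Unset Strict Implicit.
Unset Printing Implicit Defensive.

Local Open Scope classical_set_scope.
Local Open Scope ring_scope.

(** The alternating projections reduce to a scalar recursion. The point of
    [epi f] nearest to [(x, 0)] is [(y, f y)], where [y] minimizes
    [(y - x)^2 + (f y)^2]; Fermat's rule gives [x = y + f y * f' y]. Hence, with
    [h = f * f'], the iterates satisfy [x n = x n.+1 + h (x n.+1)] as soon as
    they have entered the interval on which [f] is differentiable
    ([minimizes_stationary]). They do enter it, because they decrease to [0] for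
    any even convex [f] vanishing only at the origin ([minimizes_iter_cvg0]).

    Convexity and [f' 0 = 0] give [h y / y -> 0] as [y -> 0+]
    ([slope_prod_cvg0]), that is [c_1 = 0]; the other assertions of (i) only
    compare powers of [y].

    The rates come from the scalar recursion alone. With [s = q - 1 > 0], the
    sequence [u n = x n `^ (- s)] has increments asymptotic to
    [s * h y / y `^ q] at [y = x n.+1], hence converging to [s * c_q]; by
    Stolz-Cesaro [u n / n] tends to [s * c_q] as well
    ([recursion_power_growth]). Taking [- (1 / s)]-th powers gives (iii), the
    limits being taken in the extended reals so as to cover [c_q = +oo], and the
    case [c_q = 0] gives the lower bound of (ii) for [q > 1]. When [q = 1] the
    same argument is run with [u n = - ln (x n)]. *)

Lemma is_derive_quotient (R : realType) (f : R -> R) (a df : R) :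
  is_derive a 1 f df -> (f (a + h) - f a) / h @[h --> 0^'] --> df.
Proof.
case=> dv <-; have : _ --> 'D_1 f a := dv.
apply: cvg_trans; apply: near_eq_cvg; near=> h.
by rewrite /= /GRing.scale/= mulr1 (addrC h) mulrC.
Unshelve. all: end_near. Qed.

(** * Even convex functions vanishing only at the origin *)

Definition even_convex (R : realType) (f : R -> \bar R) : Prop :=
  [/\ econvex f, (forall x : R, f (- x) = f x), f 0 = 0%E &
      forall x : R, x != 0 -> (0 < f x)%E].

Lemma even_convex_ge0 (R : realType) (f : R -> \bar R) (z : R) :
  even_convex f -> (0 <= f z)%E.
Proof.
case=> _ _ f0 f_gt0; have [->|z0] := eqVneq z 0; first by rewrite f0.
exact/ltW/f_gt0.
Qed.

Lemma even_convex_scale (R : realType) (f : R -> \bar R) (t z : R) :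
  even_convex f -> 0 <= t <= 1 -> (f (t * z)%R <= t%:E * f z)%E.
Proof.
move=> [f_convex _ f0 _] t01; have := f_convex z 0 t t01.
by rewrite f0 mule0 adde0 mulr0 addr0.
Qed.

(** By evenness [y] and [z] may be replaced by their absolute values, and then
    [y] is a contraction of [z] towards the origin, where [f] is least. *)
Lemma even_convex_mono (R : realType) (f : R -> \bar R) (y z : R) :
  even_convex f -> `|y| <= `|z| -> (f y <= f z)%E.
Proof.
move=> fec yz; have [_ f_even f0 _] := fec.
have fabs w : f `|w| = f w by have [_|_] := ler0P w; rewrite ?f_even.
rewrite -(fabs y) -(fabs z); have [z0|z0] := eqVneq z 0.
  by move: yz; rewrite z0 normr0 normr_le0 => /eqP ->; rewrite normr0.
have az : 0 < `|z| by rewrite normr_gt0.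
have t01 : 0 <= `|y| / `|z| <= 1 by rewrite divr_ge0//= ler_pdivrMr// mul1r.
have -> : `|y| = `|y| / `|z| * `|z| by rewrite divfK// gt_eqF.
apply: (le_trans (even_convex_scale `|z| fec t01)).
by rewrite gee_pMl ?even_convex_ge0// lee_fin; case/andP: t01.
Qed.

Lemma even_convex_fin (R : realType) (f : R -> \bar R) (y z : R) :
  even_convex f -> edom f z -> `|y| <= `|z| -> f y \is a fin_num.
Proof.
move=> fec fz yz; rewrite ge0_fin_numE ?even_convex_ge0//.
exact: le_lt_trans (even_convex_mono fec yz) fz.
Qed.

Lemma fine_mono (R : realType) (f : R -> \bar R) (y z : R) :
  even_convex f -> edom f z -> `|y| <= `|z| -> fine (f y) <= fine (f z).
Proof.
move=> fec fz yz; rewrite fine_le ?even_convex_mono//.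
- exact: even_convex_fin fz yz.
- exact: even_convex_fin fz _.
Qed.

Lemma even_convex_fine_gt0 (R : realType) (f : R -> \bar R) (z : R) :
  even_convex f -> edom f z -> z != 0 -> 0 < fine (f z).
Proof. by move=> [_ _ _ f_gt0] fz z0; rewrite fine_gt0// f_gt0. Qed.

Lemma fine_convex (R : realType) (f : R -> \bar R) (y z t : R) :
  even_convex f -> edom f y -> edom f z -> 0 <= t <= 1 ->
  fine (f (t * y + (1 - t) * z)) <= t * fine (f y) + (1 - t) * fine (f z).
Proof.
move=> fec fy fz t01; have [f_convex _ _ _] := fec.
have fyE : f y = (fine (f y))%:E by rewrite fineK// (even_convex_fin fec fy).
have fzE : f z = (fine (f z))%:E by rewrite fineK// (even_convex_fin fec fz).
have := f_convex y z t t01; rewrite fyE fzE -!EFinM -EFinD /=.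
have := even_convex_ge0 (t * y + (1 - t) * z) fec.
by case: (f _).
Qed.

Lemma fine_scale (R : realType) (f : R -> \bar R) (z t : R) :
  even_convex f -> edom f z -> 0 <= t <= 1 ->
  fine (f (t * z)) <= t * fine (f z).
Proof.
move=> fec fz t01; have [_ _ f0 _] := fec.
have d0 : edom f 0 by rewrite /edom /= f0.
by have := fine_convex fec fz d0 t01; rewrite f0 /= !mulr0 !addr0.
Qed.

(** The chord from the origin to [y] is less steep than the tangent at [y]:
    difference quotients from the left at [y] are at least [f y / y]. *)
Lemma le_derive_even_convex (R : realType) (f : R -> \bar R) (y : R) :
  even_convex f -> 0 < y -> edom f y -> ederivable f y ->
  fine (f y) <= y * ederive f y.
Proof.
move=> fec y0 fy [_ /derivableP]; rewrite -derive1E => /is_derive_quotient dq.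
rewrite -ler_pdivrMl//; apply: (cvgr_to_ge (cvg_dnbhs_at_left dq)).
near=> h.
have h0 : h < 0 by near: h; exact: nbhs_left_lt.
have hy : - y < h by near: h; apply: nbhs_left_gt; rewrite oppr_lt0.
have -> : y + h = (1 + h / y) * y by rewrite mulrDl mul1r divfK// gt_eqF.
have t01 : 0 <= 1 + h / y <= 1.
  rewrite gerDl ler_pdivrMr// mul0r (ltW h0) andbT.
  by rewrite -(mulfV (lt0r_neq0 y0)) -mulrDl divr_ge0 ?(ltW y0)//; lra.
have := fine_scale fec fy t01.
rewrite ler_ndivlMr//; set F := fine _ => FF.
suff : y^-1 * fine (f y) * h = h / y * fine (f y) by lra.
by ring.
Unshelve. all: end_near. Qed.

(** The tangent at [y] lies below the chord from [y] to [2 * y]. This bounds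
    [f'] by values of [f], so that [f' y -> 0] as [y -> 0+] follows from
    [f' 0 = 0]. *)
Lemma derive_even_convex_le (R : realType) (f : R -> \bar R) (y : R) :
  even_convex f -> 0 < y -> edom f (2 * y) -> ederivable f y ->
  y * ederive f y <= fine (f (2 * y)).
Proof.
move=> fec y0 f2y [_ /derivableP]; rewrite -derive1E => /is_derive_quotient dq.
have fy : edom f y.
  apply: le_lt_trans f2y; apply: even_convex_mono fec _.
  by rewrite !gtr0_norm ?mulr_gt0//; lra.
rewrite -ler_pdivlMl//; apply: (cvgr_to_le (cvg_dnbhs_at_right dq)).
near=> h.
have h0 : 0 < h by near: h; exact: nbhs_right_gt.
have hy : h < y by near: h; exact: nbhs_right_lt.
have t01 : 0 <= h / y <= 1.
  by rewrite ler_pdivrMr// mul1r (ltW hy) andbT divr_ge0// ltW.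
have := fine_convex fec f2y fy t01.
have -> : h / y * (2 * y) + (1 - h / y) * y = y + h.
  by field; rewrite gt_eqF.
rewrite ler_pdivrMr// => FF.
have F0 : 0 <= fine (f y) by rewrite fine_ge0// even_convex_ge0.
have : 0 <= h / y * fine (f y) by rewrite mulr_ge0//; case/andP: t01.
suff : y^-1 * fine (f (2 * y)) * h = h / y * fine (f (2 * y)) by lra.
by ring.
Unshelve. all: end_near. Qed.

Lemma slope0_even_convex (R : realType) (f : R -> \bar R) :
  even_convex f -> ederivable f 0 -> ederive f 0 = 0 ->
  fine (f y) / y @[y --> 0^'+] --> 0.
Proof.
move=> [_ _ f0 _] [_ /derivableP]; rewrite -derive1E.
rewrite /ederive => + d0; rewrite d0 => /is_derive_quotient dq.
have := cvg_dnbhs_at_right dq; rewrite f0/=.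
apply: cvg_trans; apply: near_eq_cvg; near=> h.
by rewrite add0r subr0.
Unshelve. all: end_near. Qed.

(** * Nearest points of the epigraph *)

(** If [r < f y], pick [s] strictly between them: lower semicontinuity keeps
    [f] above [s] near [y], while the heights below [s] form a neighbourhood
    of [r]. *)
Lemma closed_epi (R : realType) (f : R -> \bar R) :
  lower_semicontinuous f -> closed (epi f).
Proof.
move=> f_lsc; rewrite -[epi f]setCK; apply: open_closedC; rewrite openE.
move=> [y r] /= /negP; rewrite -ltNge => rf.
have [s rs sf] : exists2 s : R, r < s & (s%:E < f y)%E.
  case: (f y) rf => [t| |]//; rewrite ?lte_fin => rt.
    by exists ((r + t) / 2); rewrite ?lte_fin midf_lt.
  by exists (r + 1); rewrite ?ltry// ltrDl.
have [V Vy Vf] := f_lsc y s sf.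
exists (V, [set t | t < s]).
  by split => //=; apply: open_nbhs_nbhs; split => //; exact: open_lt.
move=> [z t] /= [Vz ts]; apply/negP; rewrite -ltNge.
by apply: lt_trans (Vf z Vz); rewrite lte_fin.
Qed.

Lemma eucl_dist_le (R : realType) (u p z : R * R) :
  (eucl_dist u p <= eucl_dist u z) =
  ((p.1 - u.1) ^+ 2 + (p.2 - u.2) ^+ 2 <= (z.1 - u.1) ^+ 2 + (z.2 - u.2) ^+ 2).
Proof.
rewrite /eucl_dist ler_sqrt ?addr_ge0 ?sqr_ge0//.
by congr (_ <= _); ring.
Qed.

Lemma plane_proj_axis (R : realType) (u : R * R) :
  plane_proj (setT `*` [set 0]) u = (u.1, 0).
Proof.
rewrite /plane_proj; set P := (X in get X).
have /getPex : exists p, P p.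
  exists (u.1, 0); split => // z [_ /= z2].
  by rewrite eucl_dist_le /= z2 subrr expr0n add0r lerDr sqr_ge0.
move: (get P) => [p1 p2] [[_ /= ->] /(_ (u.1, 0)) pmin].
have {pmin} := pmin (conj I erefl).
rewrite eucl_dist_le /= subrr expr0n /= !add0r gerDr => p1u.
have : (p1 - u.1) ^+ 2 == 0 by rewrite eq_le p1u sqr_ge0.
by rewrite sqrf_eq0 subr_eq0 => /eqP ->.
Qed.

(** The whole epigraph retracts, without increasing the distance to [(x, 0)],
    onto its part inside the rectangle [[0, x] * [0, f x]], by reflecting the
    abscissa to the positive side and truncating both coordinates. That part is
    compact, so the distance attains its minimum there. *)
Lemma nearest_epi_exists (R : realType) (f : R -> \bar R) (x : R) :
  even_convex f -> lower_semicontinuous f -> 0 < x -> edom f x ->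
  exists p, epi f p /\
    forall z, epi f z -> eucl_dist (x, 0) p <= eucl_dist (x, 0) z.
Proof.
move=> fec f_lsc x0 fx; have [_ _ f0 _] := fec.
pose M := fine (f x).
have fxE : f x = M%:E by rewrite fineK// (even_convex_fin fec fx).
pose K := epi f `&` (`[0, x] `*` `[0, M]).
have M0 : 0 <= M by rewrite fine_ge0// even_convex_ge0.
have K0 : K !=set0.
  exists (0, 0); split => /=; first by rewrite /epi/= f0.
  by split => /=; rewrite in_itv/= lexx// ltW.
have cK : compact K.
  rewrite /K setIC; apply: compact_closedI; last exact: closed_epi.
  by apply: compact_setX; exact: segment_compact.
pose g (z : R * R) := (z.1 - x) ^+ 2 + (z.2 - 0) ^+ 2.
have cg : continuous g.
  move=> z; rewrite /g.
  have c1 : (z.1 - x) @[z --> z] --> z.1 - x.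
    by apply: cvgB; [exact: cvg_fst|exact: cvg_cst].
  have c2 : (z.2 - 0) @[z --> z] --> z.2 - 0.
    by apply: cvgB; [exact: cvg_snd|exact: cvg_cst].
  by apply: cvgD; [exact: (cvgM c1 c1)|exact: (cvgM c2 c2)].
have [p /set_mem [pf _] pmin] :=
  compact_EVT_min K0 cK (continuous_subspaceT cg).
exists p; split => // z zf; rewrite eucl_dist_le/= -/(g p) -/(g z).
have z20 : 0 <= z.2.
  by rewrite -lee_fin; apply: le_trans zf; exact: even_convex_ge0.
pose z' := (Num.min `|z.1| x, Num.min z.2 M).
have Kz' : z' \in K.
  apply/mem_set; split; rewrite /z'/=.
    have m_ge0 : 0 <= Num.min `|z.1| x by rewrite le_min normr_ge0 ltW.
    rewrite /epi/=; have [_|_] := leP z.2 M.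
      apply: le_trans zf; apply: even_convex_mono fec _.
      by rewrite (ger0_norm m_ge0) ge_min lexx.
    rewrite -fxE; apply: even_convex_mono fec _.
    by rewrite (ger0_norm m_ge0) (gtr0_norm x0) ge_min lexx orbT.
  split => /=; rewrite in_itv/= le_min ge_min lexx orbT andbT.
    by rewrite normr_ge0 ltW.
  by rewrite z20 M0.
apply: le_trans (pmin _ Kz') _; rewrite /g /z'/= !subr0 lerD//.
  have [zx|zx] := leP `|z.1| x; last by rewrite subrr expr0n sqr_ge0.
  have [z10|z10] := ger0P z.1; first by [].
  by rewrite -subr_ge0 (_ : _ - _ = 4 * (- z.1 * x)); [nra|ring].
by rewrite ler_sqr ?nnegrE ?le_min ?z20 ?M0// ge_min lexx.
Qed.

(** * The iterates decrease to the origin *)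

(** One step of the alternating projections, seen on abscissae: the point of the
    epigraph nearest to [(x, 0)] lies on the graph, above a minimizer of the
    squared distance to the graph. *)
Definition minimizes (R : realType) (f : R -> \bar R) (x y : R) : Prop :=
  edom f y /\ forall z, edom f z ->
    (y - x) ^+ 2 + fine (f y) ^+ 2 <= (z - x) ^+ 2 + fine (f z) ^+ 2.

Lemma minimizes_plane_proj_epi (R : realType) (f : R -> \bar R) (x : R) :
  even_convex f -> lower_semicontinuous f -> 0 < x -> edom f x ->
  minimizes f x
    (plane_proj (setT `*` [set 0]) (plane_proj (epi f) (x, 0))).1.
Proof.
move=> fec f_lsc x0 fx; rewrite plane_proj_axis /=.
have := getPex (nearest_epi_exists fec f_lsc x0 fx).
rewrite -/(plane_proj (epi f) (x, 0)).
case: (plane_proj _ _) => y r [/= fyr pmin].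
have fy : edom f y by apply: le_lt_trans fyr _; rewrite ltry.
have fyE : f y = (fine (f y))%:E by rewrite fineK// (even_convex_fin fec fy).
have yr : fine (f y) <= r by rewrite -lee_fin -fyE.
split => // z fz.
have /pmin : epi f (z, fine (f z)).
  by rewrite /epi/= fineK// (even_convex_fin fec fz).
rewrite eucl_dist_le/= !subr0; apply: le_trans.
have F0 : 0 <= fine (f y) by rewrite fine_ge0// even_convex_ge0.
by rewrite lerD2l ler_sqr ?nnegrE// (le_trans F0).
Qed.

(** Reflecting a negative [y] or replacing [y > x] by [x] would bring the point
    of the graph strictly closer to [(x, 0)]. *)
Lemma minimizes_bounds (R : realType) (f : R -> \bar R) (x y : R) :
  even_convex f -> 0 < x -> edom f x -> minimizes f x y -> 0 <= y <= x.
Proof.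
move=> fec x0 fx [fy ymin]; have [_ f_even _ _] := fec.
apply/andP; split; rewrite leNgt; apply/negP => yx.
  have := ymin (- y); rewrite /edom/= f_even => /(_ fy); nra.
have := ymin x fx; rewrite subrr expr0n add0r.
have : fine (f x) <= fine (f y).
  by apply: fine_mono => //; rewrite !gtr0_norm ?ltW//; exact: lt_trans yx.
have : 0 <= fine (f x) by rewrite fine_ge0// even_convex_ge0.
nra.
Qed.

(** Fermat's rule for the squared distance. Differentiability is asked at
    the single point [y], so as to apply at the origin as well, where it shows
    that the iterates never reach [0]. *)
Lemma minimizes_stationary (R : realType) (f : R -> \bar R) (x y : R) :
  minimizes f x y -> ederivable f y -> x = y + fine (f y) * ederive f y.
Proof.
move=> [fy ymin] [f_fin /derivableP]; rewrite -derive1E -/(ederive f y) => dF.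
set F := fun z => fine (f z).
pose G z := (z - x) * (z - x) + F z * F z.
have dG : is_derive y 1 G (2 * (y - x) + 2 * (F y * ederive f y)).
  apply: is_derive_eq; rewrite /GRing.scale/=; ring.
have dq := is_derive_quotient dG.
have Gmin : \forall h \near 0, G y <= G (y + h).
  move: f_fin; rewrite nbhs0P => f_fin; apply: filterS f_fin => h fh.
  by rewrite /G /F -!expr2; apply: ymin; rewrite /edom /= ltey_eq fh.
suff : 2 * (y - x) + 2 * (F y * ederive f y) = 0 by rewrite /F; lra.
apply/eqP; rewrite eq_le; apply/andP; split.
  apply: (cvgr_to_le (cvg_dnbhs_at_left dq)); near=> h.
  have h0 : h < 0 by near: h; exact: nbhs_left_lt.
  rewrite ler_ndivrMr// mul0r subr_ge0; near: h; apply: cvg_within; exact: Gmin.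
apply: (cvgr_to_ge (cvg_dnbhs_at_right dq)); near=> h.
have h0 : 0 < h by near: h; exact: nbhs_right_gt.
rewrite ler_pdivlMr// mul0r subr_ge0; near: h; apply: cvg_within; exact: Gmin.
Unshelve. all: end_near. Qed.

(** Both [x n] and [f (x n)] decrease, to limits [L] and [P]. If [L > 0] then
    [P >= f L > 0]. Comparing the minimizer [x n.+1] with [(1 - t) * x n] and
    letting [n] grow gives [P^2 <= t^2 L^2 + (1 - t)^2 P^2] for every
    [t] in [[0, 1]], which fails for small [t > 0]. The argument uses the
    values of [f] only, because the first iterates may lie where [f] is not
    differentiable. *)
Lemma minimizes_iter_cvg0 (R : realType) (f : R -> \bar R) (x : nat -> R) :
  even_convex f -> (forall n, 0 < x n) -> (forall n, edom f (x n)) ->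
  (forall n, minimizes f (x n) (x n.+1)) -> x n @[n --> \oo] --> 0.
Proof.
move=> fec x_gt0 fx xmin.
have xnoninc : nonincreasing_seq x.
  apply/nonincreasing_seqP => n.
  by have /andP[] := minimizes_bounds fec (x_gt0 n) (fx n) (xmin n).
pose F n := fine (f (x n)).
have F_ge0 n : 0 <= F n by rewrite fine_ge0// even_convex_ge0.
have Fnoninc : nonincreasing_seq F.
  move=> m n mn; apply: fine_mono => //.
  by rewrite !gtr0_norm//; exact: xnoninc.
have xcvg : x n @[n --> \oo] --> limn x.
  apply: nonincreasing_is_cvgn => //.
  by exists 0 => _ [n _ <-]; exact: ltW.
have Fcvg : F n @[n --> \oo] --> limn F.
  by apply: nonincreasing_is_cvgn => //; exists 0 => _ [n _ <-].
move: xcvg Fcvg; set L := limn x; set P := limn F => xcvg Fcvg.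
have L_ge0 : 0 <= L by apply: (cvgr_to_ge xcvg); near=> n; exact: ltW.
have [L_gt0|] := ltP 0 L; last first.
  by move=> L_le0; have <- : L = 0 by apply/eqP; rewrite eq_le L_le0.
have Lx n : L <= x n.
  by apply: nonincreasing_cvgn_ge => //; apply/cvg_ex; exists L.
have fL : edom f L.
  apply: le_lt_trans (fx 0%N); apply: even_convex_mono fec _.
  by rewrite !gtr0_norm.
have P_gt0 : 0 < P.
  apply: (@lt_le_trans _ _ (fine (f L))); first exact:
    (even_convex_fine_gt0 fec fL (lt0r_neq0 L_gt0)).
  apply: (cvgr_to_ge Fcvg); near=> n; apply: fine_mono => //.
  by rewrite !gtr0_norm.
have key t : 0 <= t <= 1 ->
    P * P <= t * L * (t * L) + (1 - t) * P * ((1 - t) * P).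
  move=> /andP[t0 t1].
  have t01 : 0 <= 1 - t <= 1 by lra.
  have FScvg : F n.+1 @[n --> \oo] --> P by rewrite -cvg_shiftS in Fcvg.
  have Lcvg : t * x n @[n --> \oo] --> t * L.
    by apply: cvgM => //; exact: cvg_cst.
  have tFcvg : (1 - t) * F n @[n --> \oo] --> (1 - t) * P.
    by apply: cvgM => //; exact: cvg_cst.
  apply: (ler_cvg_to (cvgM FScvg FScvg)
    (cvgD (cvgM Lcvg Lcvg) (cvgM tFcvg tFcvg))).
  near=> n; have [_ /(_ ((1 - t) * x n))] := xmin n.
  have le1 : `|(1 - t) * x n| <= `|x n|.
    by rewrite normrM ler_piMl// ger0_norm; lra.
  have d1 : edom f ((1 - t) * x n).
    exact: le_lt_trans (even_convex_mono fec le1) (fx n).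
  move=> /(_ d1).
  have := fine_scale fec (fx n) t01.
  have : 0 <= fine (f ((1 - t) * x n)) by rewrite fine_ge0// even_convex_ge0.
  rewrite -/(F n) -/(F n.+1) /= => s0 s1 s2.
  have := sqr_ge0 (x n.+1 - x n).
  have s3 : fine (f ((1 - t) * x n)) ^+ 2 <= ((1 - t) * F n) ^+ 2.
    by rewrite ler_sqr ?nnegrE// (le_trans s0).
  have s4 : ((1 - t) * x n - x n) ^+ 2 = t * x n * (t * x n) by ring.
  move: s2 s3; rewrite s4 /= !expr2 => s2 s3 s5.
  change (F n.+1 * F n.+1 <=
    t * x n * (t * x n) + (1 - t) * F n * ((1 - t) * F n)).
  lra.
exfalso.
have D0 : 0 < L ^+ 2 + P ^+ 2 by rewrite addr_gt0 ?exprn_gt0.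
(* the minimizer of [t^2 L^2 + (1 - t)^2 P^2] *)
pose t := P ^+ 2 / (L ^+ 2 + P ^+ 2).
have t0 : 0 < t by rewrite divr_gt0 ?exprn_gt0.
have tE : t * (L ^+ 2 + P ^+ 2) = P ^+ 2 by rewrite divfK ?gt_eqF.
have t1 : t <= 1 by rewrite ler_pdivrMr// mul1r lerDr exprn_ge0// ltW.
have := key t; rewrite (ltW t0) t1 => /(_ isT).
suff -> : t * L * (t * L) + (1 - t) * P * ((1 - t) * P) =
    P * P - t * P ^+ 2.
  have : 0 < t * P ^+ 2 by rewrite mulr_gt0 ?exprn_gt0.
  lra.
have -> : t * L * (t * L) + (1 - t) * P * ((1 - t) * P) =
   t * (t * (L ^+ 2 + P ^+ 2)) + P * P - t * P ^+ 2 *+ 2 by ring.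
rewrite tE; ring.
Unshelve. all: end_near. Qed.

(** The positivity needed to iterate comes from [minimizes_stationary] at the
    origin: if [x n.+1 = 0], then [x n = 0 + f 0 * f' 0 = 0]. *)
Lemma alternating_proj_minimizes (R : realType) (f : R -> \bar R)
    (a : nat -> R * R) (x : nat -> R) :
  even_convex f -> lower_semicontinuous f ->
  ederivable f 0 -> 0 < x 0%N -> edom f (x 0%N) ->
  (forall n, a n.+1 =
     plane_proj (setT `*` [set 0]) (plane_proj (epi f) (a n))) ->
  (forall n, a n = (x n, 0)) ->
  forall n, [/\ 0 < x n, edom f (x n) & minimizes f (x n) (x n.+1)].
Proof.
move=> fec f_lsc f_der0 x0_gt0 fx0 aS ax.
have step n : 0 < x n -> edom f (x n) -> minimizes f (x n) (x n.+1).
  move=> xn fxn; have := minimizes_plane_proj_epi fec f_lsc xn fxn.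
  by rewrite -ax -aS ax.
suff pos n : 0 < x n /\ edom f (x n).
  by move=> n; have [xn fxn] := pos n; split => //; exact: step.
elim: n => // n [xn fxn]; have xmin := step n xn fxn.
split; last by case: xmin.
have /andP[xS0 _] := minimizes_bounds fec xn fxn xmin.
rewrite lt_neqAle xS0 andbT; apply/eqP => x0E; have [_ _ f0 _] := fec.
move: xmin; rewrite -x0E => /minimizes_stationary/(_ f_der0).
by rewrite f0 mul0r addr0 => xn0; rewrite xn0 ltxx in xn.
Qed.

(** * Rates for a recursion tangent to the identity *)

(** Summing the increments bounds [u n] by [a * n] up to a constant, which the
    slack [b - a] absorbs for large [n]. *)
Lemma increments_le_near (R : realType) (u : nat -> R) (a b : R) : a < b ->
  (\forall n \near \oo, u n.+1 - u n <= a) ->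
  \forall n \near \oo, u n <= b * n%:R.
Proof.
move=> ab [N _ uN].
have ule k : u (N + k)%N <= u N + a * k%:R.
  elim: k => [|k IH]; first by rewrite addn0 mulr0 addr0.
  have := uN (N + k)%N (leq_addr _ _); rewrite addnS -natr1 /=; lra.
have ba : 0 < b - a by rewrite subr_gt0.
near=> n.
have Nn : (N <= n)%N by near: n; exact: nbhs_infty_ge.
have nbig : (u N - a * N%:R) / (b - a) <= n%:R.
  by near: n; exact: nbhs_infty_ger.
have := ule (n - N)%N; rewrite subnKC// natrB//.
move: nbig; rewrite ler_pdivrMr//; nra.
Unshelve. all: end_near. Qed.

Lemma increments_ge_near (R : realType) (u : nat -> R) (a b : R) : b < a ->
  (\forall n \near \oo, a <= u n.+1 - u n) ->
  \forall n \near \oo, b * n%:R <= u n.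
Proof.
move=> ba ua.
have nba : - a < - b by rewrite ltrN2.
have := @increments_le_near _ (fun n => - u n) _ _ nba.
have ua' : \forall n \near \oo, - u n.+1 - - u n <= - a.
  by apply: filterS ua => n; lra.
by move=> /(_ ua'); apply: filterS => n; lra.
Qed.

(** The Stolz-Cesaro theorem, including the case of an infinite limit. *)
Lemma cesaro_increments (R : realType) (u : nat -> R) (d : \bar R) :
  (0 <= d)%E -> (u n.+1 - u n)%:E @[n --> \oo] --> d ->
  (u n / n%:R)%:E @[n --> \oo] --> d.
Proof.
case: d => [d _ | _ | //] ud.
- apply/fine_cvgP; split; first by near=> n.
  have {}ud : u n.+1 - u n @[n --> \oo] --> d by move/fine_cvgP : ud => [].
  apply/cvgrPdist_le => e e0 /=.
  have e20 : 0 < e / 2 by rewrite divr_gt0.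
  move/cvgrPdist_le : ud => /(_ _ e20) ud.
  have up : \forall n \near \oo, u n <= (d + e) * n%:R.
    apply: (@increments_le_near _ _ (d + e / 2)); first lra.
    by apply: filterS ud => n; rewrite ler_norml; lra.
  have lo : \forall n \near \oo, (d - e) * n%:R <= u n.
    apply: (@increments_ge_near _ _ (d - e / 2)); first lra.
    by apply: filterS ud => n; rewrite ler_norml; lra.
  near=> n.
  have n0 : (0 : R) < n%:R by rewrite ltr0n; near: n; exact: nbhs_infty_gt.
  have : u n / n%:R <= d + e by rewrite ler_pdivrMr//; near: n.
  have : d - e <= u n / n%:R by rewrite ler_pdivlMr//; near: n.
  by rewrite ler_norml; lra.
- apply/cvgeyPge => M; move/cvgeyPge : ud => /(_ (M + 1)) ud.
  have lo : \forall n \near \oo, M * n%:R <= u n.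
    apply: (@increments_ge_near _ _ (M + 1)); first lra.
    by apply: filterS ud => n; rewrite lee_fin.
  near=> n.
  have n0 : (0 : R) < n%:R by rewrite ltr0n; near: n; exact: nbhs_infty_gt.
  by rewrite lee_fin ler_pdivlMr//; near: n.
Unshelve. all: end_near. Qed.

(** This is minus the derivative of [(1 + r) `^ (- s)] at [r = 0]. *)
Lemma powR_quotient_cvg0 (R : realType) (s : R) :
  (1 - (1 + r) `^ (- s)) / r @[r --> 0^'] --> s.
Proof.
have := @is_derive1_powR R (- s) 1 ltr01.
move=> /is_derive_quotient; rewrite !powR1 mulr1 => /cvgN; rewrite opprK.
apply: cvg_trans; apply: near_eq_cvg; near=> r.
by rewrite /= -mulNr opprB.
Unshelve. all: end_near. Qed.

Lemma cvg_at_right0 (R : realType) (I : Type) (F : set_system I)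
    {FF : Filter F} (u : I -> R) :
  (\forall i \near F, 0 < u i) -> u i @[i --> F] --> 0 ->
  u i @[i --> F] --> 0^'+.
Proof.
move=> u_gt0 u_0 P /= /u_0 /= Pu; rewrite /nbhs/=.
by apply: filterS2 u_gt0 Pu => i /= ui; apply.
Qed.

Lemma cvg_shift_at_right0 (R : realType) (x : nat -> R) :
  (forall n, 0 < x n) -> x n @[n --> \oo] --> 0 -> x n.+1 @[n --> \oo] --> 0^'+.
Proof.
move=> x_gt0 x_0; apply: cvg_at_right0; first by near=> n.
by rewrite -cvg_shiftS in x_0.
Unshelve. all: end_near. Qed.

(** The change of variable [u n = x n `^ (- s)] linearizes the recursion. With
    [r = h (x n.+1) / x n.+1], which tends to [0],
      [u n.+1 - u n = x n.+1 `^ (- s) * (1 - (1 + r) `^ (- s))],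
    and [1 - (1 + r) `^ (- s)] is equivalent to [s * r]; hence the increments
    of [u] behave like [s * h y / y `^ (s + 1)] at [y = x n.+1]. *)
Lemma recursion_power_growth (R : realType) (h : R -> R) (x : nat -> R)
    (s : R) (c : \bar R) :
  0 < s -> (0 <= c)%E -> (forall n, 0 < x n) -> x n @[n --> \oo] --> 0 ->
  (\forall y \near 0^'+, 0 < h y) ->
  h y / y @[y --> 0^'+] --> 0 ->
  (\forall n \near \oo, x n = x n.+1 + h (x n.+1)) ->
  (h y / y `^ (s + 1))%:E @[y --> 0^'+] --> c ->
  (x n `^ (- s) / n%:R)%:E @[n --> \oo] --> (s%:E * c)%E.
Proof.
move=> s0 c0 x_gt0 x_0 h_gt0 hr rec hc.
have xS0 := cvg_shift_at_right0 x_gt0 x_0.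
have hx : \forall n \near \oo, 0 < h (x n.+1) := xS0 _ h_gt0.
have r0 : h (x n.+1) / x n.+1 @[n --> \oo] --> 0^'+.
  apply: cvg_at_right0; last exact:
    (cvg_comp (fun n => x n.+1) (fun y => h y / y) xS0 hr).
  apply: filterS hx => n hxn.
  by rewrite divr_gt0.
have cs0 : (s%:E *? c)%E.
  case: c c0 {hc} => // _.
  by rewrite mule_def_neq0_infty// gt_eqF// lte_fin.
apply: cesaro_increments; first by rewrite mule_ge0// lee_fin ltW.
have wE : \forall n \near \oo, x n.+1 `^ (- s) - x n `^ (- s) =
    (1 - (1 + h (x n.+1) / x n.+1) `^ (- s)) / (h (x n.+1) / x n.+1) *
    (h (x n.+1) / x n.+1 `^ (s + 1)).
  near=> n.
  have hn : 0 < h (x n.+1) by near: n.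
  have rn : 0 < h (x n.+1) / x n.+1 by rewrite divr_gt0.
  have -> : x n = x n.+1 * (1 + h (x n.+1) / x n.+1).
    rewrite mulrDr mulr1 mulrC divfK ?gt_eqF//; near: n; exact: rec.
  have xs : x n.+1 `^ s != 0 by rewrite gt_eqF// powR_gt0.
  have -> : x n.+1 `^ (s + 1) = x n.+1 `^ s * x n.+1.
    rewrite powRD; first by rewrite powRr1// ltW.
    by apply/implyP => _; rewrite gt_eqF.
  rewrite powRM ?ltW ?addr_gt0// (powRN (x n.+1)).
  move: ((1 + _) `^ (- s)) => p.
  field; by rewrite xs !gt_eqF.
have phi0 := cvg_dnbhs_at_right (@powR_quotient_cvg0 R s).
have phi1 : ((1 - (1 + h (x n.+1) / x n.+1) `^ (- s)) /
    (h (x n.+1) / x n.+1))%:E @[n --> \oo] --> s%:E.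
  apply: cvg_EFin; first by near=> n.
  exact: (cvg_comp _ (fun r => (1 - (1 + r) `^ (- s)) / r) r0 phi0).
have hc1 := cvg_comp _ (fun y => (h y / y `^ (s + 1))%:E) xS0 hc.
refine (cvg_trans _ (cvgeM cs0 phi1 hc1)); apply: near_eq_cvg.
near=> n; rewrite /= -EFinM; congr (_%:E); apply/esym; near: n; exact: wE.
Unshelve. all: end_near. Qed.

Lemma powR_inv (R : realType) (t r : R) : 0 < t -> (1 / t) `^ r = 1 / t `^ r.
Proof.
move=> t0; rewrite !div1r -powRN -(powR_inv1 (ltW t0)) -powRrM.
by rewrite mulN1r.
Qed.

Lemma powR_rescale (R : realType) (x t s : R) : 0 < x -> 0 < t -> s != 0 ->
  x / (1 / t) `^ (1 / s) = (x `^ (- s) / t) `^ (- (1 / s)).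
Proof.
move=> x0 t0 s0; rewrite powRM ?powR_ge0 ?invr_ge0 ?(ltW t0)//.
rewrite -powRrM (_ : - s * - (1 / s) = 1); last by field.
rewrite powRr1 ?ltW//.
by rewrite powRN (div1r t).
Qed.

Lemma powR_split (R : realType) (y p q : R) : 0 < y ->
  y `^ q = y `^ p * y `^ (q - p).
Proof.
move=> y0; rewrite -powRD; first by rewrite addrCA subrr addr0.
by apply/implyP => _; rewrite gt_eqF.
Qed.

Lemma power_quotient_cvg0 (R : realType) (h : R -> R) (p q : R) : p < q ->
  h y / y `^ q @[y --> 0^'+] --> 0 -> h y / y `^ p @[y --> 0^'+] --> 0.
Proof.
move=> pq hq.
have qp0 : 0 < q - p by rewrite subr_gt0.
have hq0 : h y / y `^ q * y `^ (q - p) @[y --> 0^'+] --> (0 * 0 : R).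
  by apply: cvgM => //; exact: powR_cvg0.
rewrite mul0r in hq0.
refine (cvg_trans _ hq0); apply: near_eq_cvg; near=> y.
have y0 : 0 < y by near: y; exact: nbhs_right_gt.
rewrite /= (powR_split p q y0).
by field; rewrite !gt_eqF// powR_gt0.
Unshelve. all: end_near. Qed.

Lemma power_quotient_cvgy (R : realType) (h : R -> R) (p q : R) (c : \bar R) :
  p < q -> (0 < c)%E -> (h y / y `^ p)%:E @[y --> 0^'+] --> c ->
  (h y / y `^ q)%:E @[y --> 0^'+] --> +oo%E.
Proof.
move=> pq c0 hp; apply/cvgeyPge => M.
have [r r0 rc] : exists2 r : R, 0 < r & (r%:E < c)%E.
  case: c c0 {hp} => [c| |]//; rewrite ?lte_fin => c0.
    by exists (c / 2); rewrite ?lte_fin; lra.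
  by exists 1; rewrite // ltry.
have qp0 : 0 < q - p by rewrite subr_gt0.
have M0 : 0 < `|M| + 1 by rewrite ltr_wpDl.
have e0 : 0 < r / (`|M| + 1) by rewrite divr_gt0.
have hr : \forall y \near 0^'+, (r%:E < (h y / y `^ p)%:E)%E.
  exact: hp (open_ereal_gt' rc).
have ye : \forall y \near 0^'+, y `^ (q - p) < r / (`|M| + 1).
  exact: (cvgr_lt _ (powR_cvg0 qp0) _ e0).
near=> y.
have y0 : 0 < y by near: y; exact: nbhs_right_gt.
have yr : r < h y / y `^ p by rewrite -lte_fin; near: y.
have yqpr : y `^ (q - p) < r / (`|M| + 1) by near: y.
have yqp : 0 < y `^ (q - p) by rewrite powR_gt0.
have -> : h y / y `^ q = h y / y `^ p / y `^ (q - p).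
  by rewrite (powR_split p q y0) invfM mulrA.
rewrite lee_fin ler_pdivlMr//; apply: le_trans (ltW yr).
apply: (@le_trans _ _ ((`|M| + 1) * y `^ (q - p))).
  by rewrite ler_pM2r//; have := ler_norm M; lra.
by rewrite mulrC -ler_pdivlMr// ltW.
Unshelve. all: end_near. Qed.

(** By the recursion, the terms are eventually [h y / y `^ q], [y = x n.+1]. *)
Lemma recursion_ratio_cvg (R : realType) (h : R -> R) (x : nat -> R) (q l : R) :
  (forall n, 0 < x n) -> x n @[n --> \oo] --> 0 ->
  (\forall n \near \oo, x n = x n.+1 + h (x n.+1)) ->
  h y / y `^ q @[y --> 0^'+] --> l ->
  (x n / x n.+1 - 1) / (x n.+1 `^ (q - 1)) @[n --> \oo] --> l.
Proof.
move=> x_gt0 x_0 rec hq.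
have xS0 := cvg_shift_at_right0 x_gt0 x_0.
refine (cvg_trans _ (cvg_comp _ (fun y => h y / y `^ q) xS0 hq)).
apply: near_eq_cvg; near=> n.
have xn : x n = x n.+1 + h (x n.+1) by near: n.
rewrite /= xn; have -> : x n.+1 `^ q = x n.+1 * x n.+1 `^ (q - 1).
  by rewrite (powR_split 1 q (x_gt0 n.+1)) powRr1// ltW.
by field; rewrite !gt_eqF// powR_gt0.
Unshelve. all: end_near. Qed.

(** The borderline case of the power scale: here [- ln (x n)] replaces
    [x n `^ (- s)], and its increments are at most [x n / x n.+1 - 1]. *)
Lemma expR_le_recursion (R : realType) (x : nat -> R) (eps : R) :
  0 < eps -> (forall n, 0 < x n) ->
  x n / x n.+1 - 1 @[n --> \oo] --> 0 ->
  \forall n \near \oo, expR (- eps) ^+ n <= x n.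
Proof.
move=> e0 x_gt0 xr.
have : \forall n \near \oo, - ln (x n) <= eps * n%:R.
  apply: (@increments_le_near _ _ (eps / 2)); first lra.
  have e20 : 0 < eps / 2 by rewrite divr_gt0.
  have xe : \forall n \near \oo, x n / x n.+1 - 1 <= eps / 2.
    exact: (cvgr_le _ xr _ e20).
  apply: filterS xe => n xn.
  rewrite opprK addrC -ln_div ?posrE//; apply: le_trans xn.
  have := @le_ln1Dx R (x n / x n.+1 - 1).
  by rewrite addrCA subrr addr0; apply; rewrite ltrBrDl subrr divr_gt0.
apply: filterS => n xn; rewrite -expRM_natr -[leRHS]lnK ?posrE// ler_expR.
by rewrite mulNr lerNl.
Qed.

(** Dividing by the comparison sequence turns the claim into
    [x n `^ (- s) <= s * n * eps], by [powR_rescale]. *)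
Lemma power_le_recursion (R : realType) (x : nat -> R) (s eps : R) :
  0 < s -> 0 < eps -> (forall n, 0 < x n) ->
  x n `^ (- s) / n%:R @[n --> \oo] --> 0 ->
  \forall n \near \oo, 1 / (s * n%:R * eps) `^ (1 / s) <= x n.
Proof.
move=> s0 e0 x_gt0 xv.
have se0 : 0 < s * eps by rewrite mulr_gt0.
have {}xv : \forall n \near \oo, x n `^ (- s) / n%:R <= s * eps.
  exact: (cvgr_le _ xv _ se0).
near=> n.
have n0 : (0 : R) < n%:R by rewrite ltr0n; near: n; exact: nbhs_infty_gt.
have xn : x n `^ (- s) / n%:R <= s * eps by near: n.
set t := s * n%:R * eps; have t0 : 0 < t by rewrite /t !mulr_gt0.
have w0 : 0 < x n `^ (- s) / t by rewrite divr_gt0// powR_gt0.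
have w1 : x n `^ (- s) / t <= 1.
  rewrite ler_pdivrMr// mul1r; move: xn; rewrite ler_pdivrMr// /t.
  by rewrite mulrAC.
have wr : (x n `^ (- s) / t) `^ (1 / s) <= 1.
  have p1 : (1 : R) `^ (1 / s) = 1 by rewrite powR1.
  rewrite -[leRHS]p1; apply: ge0_ler_powR => //.
  - by rewrite divr_ge0// ltW.
  - by rewrite nnegrE ltW.
  - by rewrite nnegrE.
have := powR_rescale (x_gt0 n) t0 (lt0r_neq0 s0); rewrite (powRN (_ / t)) => xE.
rewrite -powR_inv// -[leLHS]mul1r -ler_pdivlMr ?powR_gt0 ?divr_gt0//.
by rewrite xE -[leLHS]invr1 lef_pV2 ?posrE ?powR_gt0.
Unshelve. all: end_near. Qed.

(** Raise the hypothesis to the power [- (1 / s)]; if [d] is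
    infinite, both the limit and [1 / d `^ (1 / s)] are [0]. *)
Lemma power_cvg_recursion (R : realType) (x : nat -> R) (s : R) (d : \bar R) :
  0 < s -> (0 < d)%E -> (forall n, 0 < x n) ->
  (x n `^ (- s) / n%:R)%:E @[n --> \oo] --> d ->
  (x n / (1 / n%:R) `^ (1 / s))%:E @[n --> \oo] --> (1 / (d `^ (1 / s)%R))%E.
Proof.
move=> s0 d0 x_gt0 xd.
suff : ((x n `^ (- s) / n%:R) `^ (- (1 / s)))%:E @[n --> \oo] -->
    (1 / (d `^ (1 / s)%R))%E.
  apply: cvg_trans; apply: near_eq_cvg; near=> n.
  have n0 : (0 : R) < n%:R by rewrite ltr0n; near: n; exact: nbhs_infty_gt.
  by rewrite /= -powR_rescale// gt_eqF.
case: d d0 xd => [d| |]//; rewrite ?lte_fin => d0 xd.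
  have {}xd : x n `^ (- s) / n%:R @[n --> \oo] --> d.
    by move/fine_cvgP : xd => [].
  rewrite poweR_EFin div1e inver gt_eqF ?powR_gt0// -powRN.
  apply: cvg_EFin; first by near=> n.
  have /derivable1_diffP/differentiable_continuous pc :
      derivable (@powR R ^~ (- (1 / s))) d 1.
    by case: (is_derive1_powR (- (1 / s)) d0).
  exact: (cvg_comp _ (@powR R ^~ (- (1 / s))) xd pc).
have s1 : 1 / s != 0 :> R by rewrite gt_eqF// divr_gt0.
rewrite /poweR (negbTE s1) div1e invey.
apply: cvg_EFin; first by near=> n.
apply/cvgr0Pnorm_le => e e0.
have {}xd : \forall n \near \oo,
    ((e `^ (- s))%:E <= (x n `^ (- s) / n%:R)%:E)%E.
  by move/cvgeyPge : xd; apply.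
near=> n.
have v : e `^ (- s) <= x n `^ (- s) / n%:R by rewrite -lee_fin; near: n.
have es : 0 < e `^ (- s) by rewrite powR_gt0.
rewrite /= ger0_norm ?powR_ge0// (powRN (_ / _)).
have -> : e = ((e `^ (- s)) `^ (1 / s))^-1.
  rewrite -powRN -powRrM (_ : - s * - (1 / s) = 1) ?powRr1 ?ltW//.
  by field; rewrite gt_eqF.
rewrite lef_pV2 ?posrE ?powR_gt0 ?(lt_le_trans es v)//.
apply: ge0_ler_powR => //; rewrite ?nnegrE ?(ltW es) ?(le_trans (ltW es) v)//.
by rewrite divr_ge0// ltW.
Unshelve. all: end_near. Qed.

(** * The growth of the product of a function and its derivative *)

(** The derivative of [f ^+ 2 / 2]: its growth at [0+] drives the iteration. *)
Definition slope_prod (R : realType) (f : R -> \bar R) (y : R) : R :=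
  fine (f y) * ederive f y.

Lemma is_c_slope_prod (R : realType) (f : R -> \bar R) (delta q : R)
    (c : \bar R) :
  0 < delta -> (forall y, 0 <= y <= delta -> ederivable f y) ->
  is_c f q c <-> (slope_prod f y / y `^ q)%:E @[y --> 0^'+] --> c.
Proof.
move=> d0 f_der.
have E : \forall y \near 0^'+, (f y * (ederive f y)%:E / (y `^ q)%:E)%E =
    (slope_prod f y / y `^ q)%:E.
  near=> y.
  have y0 : 0 < y by near: y; exact: nbhs_right_gt.
  have yd : y < delta by near: y; exact: nbhs_right_lt.
  have [fy _] : ederivable f y by apply: f_der; rewrite !ltW.
  have {}fy : f y \is a fin_num by exact: nbhs_singleton fy.
  by rewrite -(fineK fy) inver gt_eqF ?powR_gt0// /slope_prod !EFinM.
split => H; refine (cvg_trans _ H); apply: near_eq_cvg.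
  by near=> y; near: y; exact: E.
by near=> y; apply/esym; near: y; exact: E.
Unshelve. all: end_near. Qed.

Lemma slope_prod_gt0 (R : realType) (f : R -> \bar R) (delta : R) :
  even_convex f -> 0 < delta ->
  (forall y, 0 <= y <= delta -> ederivable f y) ->
  \forall y \near 0^'+, 0 < slope_prod f y.
Proof.
move=> fec d0 f_der; near=> y.
have y0 : 0 < y by near: y; exact: nbhs_right_gt.
have yd : y < delta by near: y; exact: nbhs_right_lt.
have fy : ederivable f y by apply: f_der; rewrite !ltW.
have dy : edom f y.
  by case: fy => fy _; rewrite /edom/= ltey_eq (nbhs_singleton fy).
have F0 := even_convex_fine_gt0 fec dy (lt0r_neq0 y0).
have := lt_le_trans F0 (le_derive_even_convex fec y0 dy fy).
by rewrite pmulr_rgt0// => D0; rewrite /slope_prod mulr_gt0.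
Unshelve. all: end_near. Qed.

(** Writing [f y * f' y / y = (f y / y) * f' y], both factors tend to [0]: the
    first is a difference quotient at the origin, and the second is at most
    [f (2 * y) / y]. *)
Lemma slope_prod_cvg0 (R : realType) (f : R -> \bar R) (delta : R) :
  even_convex f -> ederive f 0 = 0 -> 0 < delta ->
  (forall y, 0 <= y <= delta -> ederivable f y) ->
  slope_prod f y / y @[y --> 0^'+] --> 0.
Proof.
move=> fec f'0 d0 f_der.
have f_der0 : ederivable f 0 by apply: f_der; rewrite lexx ltW.
have sl := slope0_even_convex fec f_der0 f'0.
have two0 : 2 * y @[y --> (0:R)^'+] --> 0^'+.
  apply: cvg_at_right0.
    by near=> y; rewrite mulr_gt0//; near: y; exact: nbhs_right_gt.
  have : 2 * y @[y --> (0:R)^'+] --> (2 * 0 : R).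
    apply: cvgM; first exact: cvg_cst.
    by apply: cvg_at_right_filter; exact: cvg_id.
  by rewrite mulr0.
have sl2 := cvg_comp _ (fun y => fine (f y) / y) two0 sl.
have up : 2 * (fine (f y) / y * (fine (f (2 * y)) / (2 * y))) @[y --> 0^'+] -->
    (2 * (0 * 0) : R).
  by apply: cvgM; [exact: cvg_cst | apply: cvgM].
rewrite !mulr0 in up.
apply: (squeeze_cvgr _ (cvg_cst 0) up).
have pos := slope_prod_gt0 fec d0 f_der.
near=> y.
have y0 : 0 < y by near: y; exact: nbhs_right_gt.
have yd : y < delta / 2 by near: y; apply: nbhs_right_lt; rewrite divr_gt0.
have hy : 0 < slope_prod f y by near: y.
have fy : ederivable f y by apply: f_der; lra.
have dom z : 0 <= z <= delta -> edom f z.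
  by move=> /f_der[fz _]; rewrite /edom/= ltey_eq (nbhs_singleton fz).
have d2y : edom f (2 * y) by apply: dom; lra.
rewrite (divr_ge0 (ltW hy) (ltW y0)) /=.
have F0 : 0 <= fine (f y) by rewrite fine_ge0// even_convex_ge0.
have := derive_even_convex_le fec y0 d2y fy.
rewrite -ler_pdivlMl// => D.
have -> : 2 * (fine (f y) / y * (fine (f (2 * y)) / (2 * y))) =
    fine (f y) * (y^-1 * fine (f (2 * y))) / y.
  by field; rewrite gt_eqF.
by rewrite ler_pM2r ?invr_gt0// /slope_prod ler_wpM2l.
Unshelve. all: end_near. Qed.

Unset Implicit Arguments.

Theorem proposition4p5 (R : realType) (f : R -> \bar R)
    (f_convex : econvex f) (f_lsc : lower_semicontinuous f)
    (f_proper : proper_fun f)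
    (f_even : forall x : R, f (- x) = f x)
    (f0 : f 0 = 0%E)
    (f_gt0 : forall x : R, x != 0 -> (0 < f x)%E)
    (f_der0 : ederivable f 0) (f'0 : ederive f 0 = 0)
    (A B : set (R * R)) (defA : A = setT `*` [set 0]) (defB : B = epi f)
    (x0 : R) (x0_gt0 : 0 < x0) (x0_dom : edom f x0)
    (a : nat -> R * R) (x : nat -> R)
    (a0 : a 0%N = (x0, 0))
    (aS : forall n, a n.+1 = plane_proj A (plane_proj B (a n)))
    (ax : forall n, a n = (x n, 0))
    (delta : R) (delta_gt0 : 0 < delta)
    (f_der : forall y, 0 <= y <= delta -> ederivable f y)
    (q : R) (q_ge1 : 1 <= q) :
  (* (i) *)
  [/\ is_c f 1 0%E,
      (is_c f q 0%E -> forall q', 1 <= q' < q -> is_c f q' 0%E) &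
      (forall c, is_c f q c -> (0 < c)%E ->
         forall q', q < q' -> is_c f q' +oo%E)] /\
  (* (ii) *)
  (is_c f q 0%E ->
    ((x n / x n.+1 - 1) / (x n.+1 `^ (q - 1)) @[n --> \oo] --> 0) /\
    (forall eps, 0 < eps -> exists m, forall n, (m <= n)%N ->
       (if q == 1 then expR (- eps) ^+ n
        else 1 / (((q - 1) * n%:R * eps) `^ (1 / (q - 1)))) <= x n)) /\
  (* (iii) *)
  (forall c, is_c f q c -> (0 < c)%E ->
    1 < q /\
    (x n / ((1 / n%:R) `^ (1 / (q - 1))))%:E @[n --> \oo] -->
      (1 / (((q - 1)%:E * c) `^ (1 / (q - 1))%R))%E).
Proof.
have fec : even_convex f by [].
subst A B.
have x00 : x 0%N = x0 by have := ax 0%N; rewrite a0 => -[].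
have iter : forall n, [/\ 0 < x n, edom f (x n) & minimizes f (x n) (x n.+1)].
  by apply: (alternating_proj_minimizes fec f_lsc f_der0) aS ax; rewrite x00.
have x_gt0 n : 0 < x n by case: (iter n).
have x_0 : x n @[n --> \oo] --> 0.
  by apply: (minimizes_iter_cvg0 fec) => n; case: (iter n).
have rec : \forall n \near \oo, x n = x n.+1 + slope_prod f (x n.+1).
  have xS0 : x n.+1 @[n --> \oo] --> 0 by rewrite -cvg_shiftS in x_0.
  have xd : \forall n \near \oo, x n.+1 < delta.
    exact: (cvgr_lt _ xS0 _ delta_gt0).
  apply: filterS xd => n xd; have [_ _ xmin] := iter n.
  by apply: minimizes_stationary xmin (f_der _ _); rewrite !ltW.
have cP p c := is_c_slope_prod p c delta_gt0 f_der.
have h_gt0 := slope_prod_gt0 fec delta_gt0 f_der.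
have h0 := slope_prod_cvg0 fec f'0 delta_gt0 f_der.
have c0P p : is_c f p 0%E <-> slope_prod f y / y `^ p @[y --> 0^'+] --> 0.
  rewrite cP; split=> [/fine_cvgP[]//|H]; apply: cvg_EFin H.
  by near=> y.
have c1 : is_c f 1 0%E.
  apply/c0P; refine (cvg_trans _ h0); apply: near_eq_cvg; near=> y.
  by rewrite powRr1//; near: y; exact: nbhs_right_ge.
split; [|split].
- split => //.
  + by move=> /c0P cq q' /andP[_ q'q]; apply/c0P; exact: power_quotient_cvg0 cq.
  + by move=> c /cP cq c0 q' qq'; apply/cP; exact: power_quotient_cvgy cq.
- move=> cq; have /c0P hq := cq.
  have ratio := recursion_ratio_cvg x_gt0 x_0 rec hq.
  split => // eps e0; have [q1|q1] := eqVneq q 1.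
    have {}ratio : x n / x n.+1 - 1 @[n --> \oo] --> 0.
      refine (cvg_trans _ ratio); apply: near_eq_cvg; near=> n.
      by rewrite q1 subrr powRr0 divr1.
    have [m _ xm] := expR_le_recursion e0 x_gt0 ratio.
    by exists m => n mn; exact: xm.
  have s0 : 0 < q - 1 by rewrite subr_gt0 lt_neqAle eq_sym q1.
  have growth : (x n `^ (- (q - 1)) / n%:R)%:E @[n --> \oo] --> 0%E.
    rewrite -(mule0 (q - 1)%:E).
    apply: (recursion_power_growth (h := slope_prod f)) => //.
    by rewrite subrK; apply/cP.
  have {}growth : x n `^ (- (q - 1)) / n%:R @[n --> \oo] --> 0.
    by move/fine_cvgP : growth => [].
  have [m _ xm] := power_le_recursion s0 e0 x_gt0 growth.
  by exists m => n mn; exact: xm.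
- move=> c cq c0.
  (* [c_1 = 0], and a limit is unique *)
  have q1 : 1 < q.
    rewrite lt_neqAle q_ge1 andbT; apply/eqP => q1; rewrite -q1 in cq.
    move/cP : c1 => c1; move/cP : cq => cq.
    have c_eq0 : c = 0%E := cvg_unique (@ereal_hausdorff R) cq c1.
    by rewrite c_eq0 ltxx in c0.
  split => //; have s0 : 0 < q - 1 by rewrite subr_gt0.
  apply: power_cvg_recursion => //; first by rewrite mule_gt0.
  apply: (recursion_power_growth (h := slope_prod f)) => //; first exact: ltW.
  by rewrite subrK; apply/cP.
Unshelve. all: end_near. Qed.
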